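(* Let $n>1$ be an integer, $\mathbb{F}=\{1,-1\}$, and let $A\in M_n(\mathbb{F})$ be the matrix whose $(i,j)$-th element, for $i,j\in\{0,1,\ldots,n-1\}$, is $$A_{i,j}=(-1)^t,\quad\text{where } t\in\{0,1,\ldots,n-1\}\text{ and } ij\equiv t \pmod n.$$ Let $\mathcal{S}_j$ denote the sequency of the $j$-th column of $A$. (1) If $n$ is odd, then $A$ is sequency-complete, and $$\mathcal{S}_j=\begin{cases}0 & \text{if } j=0,\\ j-1 & \text{if } j \text{ is even and } 2\leq j<n,\\ n-j & \text{if } j\text{ is odd and } 1\leq j<n.\end{cases}$$ (2) If $n>2$ is even, then $A$ is sequency-incomplete. (3) If $n$ is even, then $\mathcal{S}_j\in\{0,n-1\}$ for all $j$, and furthermore $$\mathcal{S}_j=\begin{cases}0 & \text{if } j\text{ is even},\\ n-1 & \text{if } j \text{ is odd}.\end{cases}$$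
   Context: $M_n(\mathbb{F})$ is the set of $n\times n$ matrices with entries in $\mathbb{F}=\{1,-1\}$; rows and columns are indexed $0,1,\ldots,n-1$. The sequency of $v=[v_0\ v_1\ \cdots\ v_{n-1}]^T\in\mathbb{F}^n$ is $\mathcal{S}_v=\frac12\sum_{k=0}^{n-2}|v_k-v_{k+1}|$ (the number of sign changes). A matrix in $M_n(\mathbb{F})$ is sequency-complete if $j\mapsto\mathcal{S}_j$ is a bijection of $\{0,1,\ldots,n-1\}$ onto itself (each value $0,\ldots,n-1$ occurs as the sequency of exactly one column); otherwise it is sequency-incomplete. *)

(* Defs.v *)
From mathcomp Require Import all_boot all_order all_algebra.
Set Implicit Arguments.
Unset Strict Implicit.
Unset Printing Implicit Defensive.
Import Order.TTheory GRing.Theory Num.Theory.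
Local Open Scope ring_scope.

(* The set {1, -1}, inside rat so that the factor 1/2 in the sequency is a
   genuine division. *)
Definition pm1 : Type := {x : rat | (x == 1) || (x == -1)}.

Coercion pm1_val (x : pm1) : rat := sval x.

Lemma expN1_pm1 (t : nat) :
  ((-1) ^+ t == 1 :> rat) || ((-1) ^+ t == -1 :> rat).
Proof. by rewrite -signr_odd; case: (odd t). Qed.

Definition expN1 (t : nat) : pm1 := exist _ ((-1) ^+ t) (expN1_pm1 t).

Lemma ord_succ_subproof (n : nat) (k : 'I_n.-1) : (k.+1 < n)%N.
Proof. by rewrite -ltn_predRL. Qed.

Definition ord_here (n : nat) (k : 'I_n.-1) : 'I_n :=
  widen_ord (leq_pred n) k.

Definition ord_succ (n : nat) (k : 'I_n.-1) : 'I_n :=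
  Ordinal (ord_succ_subproof k).

Definition sequency (n : nat) (v : 'cV[pm1]_n) : rat :=
  2%:R^-1 * \sum_(k < n.-1)
    `|(v (ord_here k) 0 : rat) - (v (ord_succ k) 0 : rat)|.

Definition sequency_complete (n : nat) (A : 'M[pm1]_n) : Prop :=
  exists2 f : 'I_n -> 'I_n,
    bijective f & forall j : 'I_n, sequency (col j A) = (f j)%:R.

Definition sequency_incomplete (n : nat) (A : 'M[pm1]_n) : Prop :=
  ~ sequency_complete A.

Definition modprod_mx (n : nat) : 'M[pm1]_n :=
  \matrix_(i < n, j < n) expN1 ((i * j) %% n)%N.

(* Main.v *)
Require Import Defs.
From mathcomp Require Import all_boot all_order all_algebra.
From mathcomp Require Import zify.
Import Order.TTheory GRing.Theory Num.Theory.
Local Open Scope ring_scope.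

(** Walking down column [j], the residue [k * j %% n] grows by [j], and drops
    by [n] exactly when the addition carries past [n].  Hence the sign changes
    between rows [k] and [k.+1] exactly when [odd j (+) (odd n && carry)].

    If [n] is even, the carries are invisible to the parity: every step of an
    odd column is a sign change and no step of an even column is one
    ([sequency_modprod_even]).  Only the values [0] and [n - 1] occur, so for
    [n > 2] the value [1] is missed.

    If [n] is odd, the sign changes are the carries in an even column and the
    non-carries in an odd one.  The carries are the increments of the quotient
    [k * j %/ n], so they telescope to [(n - 1) * j %/ n], which is [j - 1] for
    [0 < j < n] ([sum_carries]).  This gives [j - 1] for even [j > 0] and
    [(n - 1) - (j - 1) = n - j] for odd [j] ([sequency_modprod_odd]).  The
    first family consists of odd numbers and the second of positive even ones,
    so the sequencies are pairwise distinct. *)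

Lemma half_dist_signr (a b : nat) :
  2%:R^-1 * `|(-1) ^+ a - (-1) ^+ b| = (odd a (+) odd b)%:R :> rat.
Proof.
by rewrite -(signr_odd _ a) -(signr_odd _ b); case: (odd a) (odd b) => [] [].
Qed.

Definition carry (n j k : nat) : bool := (n <= (k * j) %% n + j)%N.

(** A carry subtracts [n], which flips the parity only if [n] is odd. *)
Lemma odd_modn_step (n j k : nat) : (j < n)%N ->
  odd ((k * j) %% n) (+) odd ((k.+1 * j) %% n) = odd j (+) (odd n && carry n j k).
Proof.
move=> ltjn; have n_gt0 : (0 < n)%N by exact: leq_ltn_trans ltjn.
rewrite mulSn addnC modnD // (modn_small ltjn) /carry.
case: leqP => [le_n|_]; last by rewrite mul0n subn0 oddD addbA addbb andbF addbF.
by rewrite mul1n oddB // oddD andbT !addbA addbb.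
Qed.

(** A carry is an increment of the quotient [k * j %/ n], so the sum
    telescopes. *)
Lemma sum_carry (n j m : nat) : (j < n)%N ->
  (\sum_(k < m) carry n j k = (m * j) %/ n)%N.
Proof.
move=> ltjn; have n_gt0 : (0 < n)%N by exact: leq_ltn_trans ltjn.
elim: m => [|m IHm]; first by rewrite big_ord0 mul0n div0n.
rewrite big_ord_recr /= IHm mulSn [(j + _)%N]addnC divnD //.
by rewrite (divn_small ltjn) (modn_small ltjn) addn0.
Qed.

(** The last row has [(n - 1) * j = (j - 1) * n + (n - j)], with remainder
    [n - j < n] when [j > 0]. *)
Lemma sum_carries (n j : nat) : (j < n)%N ->
  (\sum_(k < n.-1) carry n j k = j.-1)%N.
Proof.
move=> ltjn; rewrite sum_carry //.
case: j ltjn => [|j] ltjn; first by rewrite muln0 div0n.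
have n_gt0 : (0 < n)%N by exact: leq_ltn_trans ltjn.
have -> : (n.-1 * j.+1 = j * n + (n - j.+1))%N by nia.
by rewrite divnMDl // divn_small ?addn0 //; lia.
Qed.

Lemma sequency_modprod (n : nat) (j : 'I_n) :
  sequency (col j (modprod_mx n)) =
    (\sum_(k < n.-1) (odd j (+) (odd n && carry n j k)))%:R.
Proof.
rewrite /sequency mulr_sumr natr_sum; apply: eq_bigr => k _.
by rewrite !mxE /= half_dist_signr odd_modn_step.
Qed.

Lemma sequency_modprod_even (n : nat) (j : 'I_n) : ~~ odd n ->
  sequency (col j (modprod_mx n)) = if odd j then n%:R - 1 else 0.
Proof.
move=> /negbTE n_even; rewrite sequency_modprod n_even /=.
rewrite sum_nat_const card_ord addbF; case: (odd j); last by rewrite muln0.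
by rewrite muln1 -subn1 natrB // (leq_ltn_trans _ (ltn_ord j)).
Qed.

(** Column [0] is covered by the even case, since [0.-1 = 0]. *)
Definition odd_order_sequency (n j : nat) : nat :=
  if odd j then (n - j)%N else j.-1.

Lemma sequency_modprod_odd (n : nat) (j : 'I_n) : odd n ->
  sequency (col j (modprod_mx n)) = (odd_order_sequency n j)%:R.
Proof.
move=> n_odd; rewrite sequency_modprod n_odd /odd_order_sequency; congr _%:R.
have := sum_carries _ _ (ltn_ord j); case: ifP => j_odd //= carries.
(* In an odd column the sign changes are the non-carries, so they are counted
   as the complement of the carries among the [n - 1] steps. *)
have : (\sum_(k < n.-1) (~~ carry n j k + carry n j k) = n.-1)%N.
  rewrite -[RHS]card_ord -sum1_card.
  by apply: eq_bigr => k _; case: (carry _ _ _).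
by rewrite big_split /= carries; have := ltn_ord j; lia.
Qed.

Lemma odd_order_sequency_lt (n j : nat) : (j < n)%N -> (odd_order_sequency n j < n)%N.
Proof. by rewrite /odd_order_sequency; case: ifP; lia. Qed.

(** The image has the same cases as the argument, told apart by parity and
    vanishing: [0] comes from [0], odd values from even [j > 0], and positive
    even values from odd [j]. *)
Lemma odd_order_sequency_inj (n i j : nat) : odd n -> (i < n)%N -> (j < n)%N ->
  odd_order_sequency n i = odd_order_sequency n j -> i = j.
Proof. by rewrite /odd_order_sequency; case: ifP; case: ifP; lia. Qed.

Lemma modprod_complete (n : nat) : odd n -> sequency_complete (modprod_mx n).
Proof.
move=> n_odd.
exists (fun j : 'I_n => Ordinal (odd_order_sequency_lt _ _ (ltn_ord j))); last first.
  by move=> j; exact: sequency_modprod_odd.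
apply: injF_bij => i j /(congr1 val) /= eq_ij.
by apply: val_inj; exact: odd_order_sequency_inj eq_ij.
Qed.

Lemma modprod_incomplete (n : nat) : (2 < n)%N -> ~~ odd n ->
  sequency_incomplete (modprod_mx n).
Proof.
move=> n_gt2 n_even [f [g _ gK] seq_f].
have lt1n : (1 < n)%N by exact: ltnW.
have := seq_f (g (Ordinal lt1n)).
rewrite gK sequency_modprod_even //=; case: ifP => _; last by [].
by rewrite -(natrB _ (ltnW lt1n)) => /eqP; rewrite eqr_nat; lia.
Qed.

Theorem theorem2p3 (n : nat) (hn : (1 < n)%N) :
  let A : 'M[pm1]_n := modprod_mx n in
  let S (j : 'I_n) : rat := sequency (col j A) in
  [/\ odd n ->
        sequency_complete A /\
        (forall j : 'I_n,
           S j = if (j == 0 :> nat)%N then 0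
                 else if odd j then n%:R - j%:R
                 else j%:R - 1),
      (2 < n)%N -> ~~ odd n -> sequency_incomplete A
    & ~~ odd n ->
        (forall j : 'I_n, S j = 0 \/ S j = n%:R - 1) /\
        (forall j : 'I_n, S j = if odd j then n%:R - 1 else 0)].
Proof.
move=> A S; split=> [n_odd||n_even].
- split=> [|j]; first exact: modprod_complete.
  rewrite /S sequency_modprod_odd // /odd_order_sequency.
  case: eqP => [->//|/eqP j_neq0]; case: ifP => _.
    by rewrite natrB // ltnW.
  by rewrite -subn1 natrB // lt0n.
- exact: modprod_incomplete.
- split=> j; rewrite /S sequency_modprod_even //.
  by case: ifP => _; [right | left].
Qed.
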